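(* There exist absolute constants $c,C\in(0,\infty)$ such that the following holds. Let $\alpha>0$ and $\delta\in(-1,0)$ be fixed real numbers with $\alpha+\delta\le\tfrac12$. Then $$\lim_{n\to\infty}\frac{\log\big(1-\mathcal{R}_n(A^\ast(\delta,\alpha;n))\big)}{\log n}=\delta .$$ More precisely, there is $n_0(\alpha,\delta)<\infty$ such that for all $n\ge n_0(\alpha,\delta)$, $$c\le\frac{1-\mathcal{R}_n(A^\ast(\delta,\alpha;n))}{n^{\delta}}\le C .$$
   Context: For positive integers $n\le N$ and a real number $A\ge 0$, let $\Theta(A,n,N)$ be the set of matrices $\boldsymbol{\theta}=(\theta_{ij})\in\mathbb{R}^{N\times N}$ for which there exist $R,C\subset\{1,\dots,N\}$ with $|R|=|C|=n$ such that $\theta_{ij}\ge A$ for all $(i,j)\in R\times C$ and $\theta_{ij}=0$ for all other $(i,j)$. For $\boldsymbol{\theta}\in\mathbb{R}^{N\times N}$ let $\mathbb{P}_{\boldsymbol{\theta}}$ denote the law of a random matrix $\mathbf{X}=(X_{ij})_{1\le i,j\le N}$ with independent entries $X_{ij}\sim N(\theta_{ij},1)$, and let $\mathbb{P}_0$ be this law for $\boldsymbol{\theta}=\mathbf{0}$. A test is a measurable function $T=T(\mathbf{X})$ with values in $\{0,1\}$. The minimax risk is $$\mathcal{R}_{n,N}(A)=\inf_{T}\Big\{\mathbb{P}_0(T=1)+\sup_{\boldsymbol{\theta}\in\Theta(A,n,N)}\mathbb{P}_{\boldsymbol{\theta}}(T=0)\Big\},$$ the infimum being over all tests. For fixed $\alpha>0$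 put $N=\lfloor n^{1+\alpha}\rfloor$ and $\mathcal{R}_n(A)=\mathcal{R}_{n,\lfloor n^{1+\alpha}\rfloor}(A)$. For $\delta\in(-1,\infty)$ define $$A^\ast(\delta,\alpha;n)=\min\Big\{n^{-(1-\alpha-\delta)},\ \sqrt{\tfrac{4(1+\delta)\alpha\log n}{n}}\Big\}.$$ ''Absolute constants'' means constants not depending on $\alpha$, $\delta$ or $n$. *)

(* Defs.v *)
From HB Require Import structures.
From mathcomp Require Import all_boot all_order all_algebra.
From mathcomp Require Import all_classical all_reals all_analysis.

Set Implicit Arguments.
Unset Strict Implicit.
Unset Printing Implicit Defensive.

Import Order.TTheory GRing.Theory Num.Theory.
Import numFieldNormedType.Exports.

Local Open Scope classical_set_scope.
Local Open Scope ring_scope.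

Definition mx_display : measure_display. Proof. exact: default_measure_display. Qed.

Section measurable_matrix.
Context {R : realType} {m n : nat}.

Definition mx_entry (ij : 'I_m * 'I_n) (X : 'M[R]_(m, n)) : measurableTypeR R :=
  X ij.1 ij.2.

(* The product (equivalently Borel) sigma-algebra on real matrices. *)
Definition mx_measurable : set (set 'M[R]_(m, n)) :=
  <<s \bigcup_(ij in [set: 'I_m * 'I_n])
        preimage_set_system setT (mx_entry ij) measurable >>.

Let mx_measurable0 : mx_measurable set0.
Proof. exact: sigma_algebra0. Qed.

Let mx_measurableC A : mx_measurable A -> mx_measurable (~` A).
Proof. exact: sigma_algebraC. Qed.

Let mx_measurable_bigcup (F : (set 'M[R]_(m, n))^nat) :
  (forall i, mx_measurable (F i)) -> mx_measurable (\bigcup_i F i).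
Proof. exact: sigma_algebra_bigcup. Qed.

HB.instance Definition _ := @isMeasurable.Build mx_display 'M[R]_(m, n)
  mx_measurable mx_measurable0 mx_measurableC mx_measurable_bigcup.

Lemma measurable_mx_entry (ij : 'I_m * 'I_n) :
  measurable_fun [set: 'M[R]_(m, n)] (mx_entry ij).
Proof.
by move=> _ Y mY; apply: sub_sigma_algebra; exists ij => //; exists Y.
Qed.

Lemma measurable_fun_mxP d (T : measurableType d) (f : T -> 'M[R]_(m, n)) :
  measurable_fun setT f <->
  forall i j, measurable_fun setT (fun t => f t i j : measurableTypeR R).
Proof.
split=> [mf i j|mf].
  by apply: (measurableT_comp (measurable_mx_entry (i, j)) mf).
move=> _ Y mY; rewrite setTI.
suff : mx_measurable `<=` [set Z | measurable (f @^-1` Z)] by apply.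
apply: smallest_sub.
  split=> [|Z /= mZ|F /= mF].
  - by rewrite /= preimage_set0.
  - by rewrite setTD preimage_setC; exact: measurableC.
  - by rewrite preimage_bigcup; exact: bigcup_measurable.
move=> _ [[i j] _ [Z mZ <-]] /=; rewrite setTI.
by have := mf i j measurableT Z mZ; rewrite setTI.
Qed.

End measurable_matrix.

Section product_law.
Context {R : realType}.
Local Notation mR := (measurableTypeR R).

Definition tcons n (x : mR * n.-tuple mR) : n.+1.-tuple mR :=
  [the n.+1.-tuple mR of x.1 :: x.2].

Lemma measurable_tcons n : measurable_fun setT (@tcons n).
Proof. exact: measurable_cons. Qed.

HB.instance Definition _ n :=
  isMeasurableFun.Build _ _ _ _ (@tcons n) (@measurable_tcons n).

(* Law of a tuple whose coordinates are independent with laws P 0, ..., P (n-1):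
   the iterated product measure. *)
Fixpoint tuple_law n :
    ('I_n -> probability mR R) -> probability (n.-tuple mR) R :=
  match n with
  | 0 => fun _ => dirac [tuple]
  | n'.+1 => fun P => distribution
      (P ord0 \x tuple_law (fun i => P (lift ord0 i)))%E (@tcons n')
  end.

Lemma tuple_lawE n (P : 'I_n -> probability mR R) (B : 'I_n -> set mR) :
  (forall i, measurable (B i)) ->
  tuple_law P [set t | forall i, B i (tnth t i)] = (\prod_(i < n) P i (B i))%E.
Proof.
elim: n P B => [|n IH] P B mB /=.
  rewrite big_ord0 diracE mem_set//= => -[]//.
rewrite big_ord_recl -IH; last by move=> i; exact: mB.
rewrite /distribution /pushforward.
rewrite -product_measure1E//; last first.
  rewrite [X in measurable X](_ : _ =
    \bigcap_(i in [set: 'I_n]) (fun t : n.-tuple mR => tnth t i) @^-1` B (lift ord0 i)).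
    apply: fin_bigcap_measurable; first exact: finite_finset.
    by move=> i _; rewrite -[X in measurable X]setTI; exact: measurable_tnth.
  by apply/seteqP; split=> t h i => [_|]; apply: h.
congr (_ _); apply/seteqP; split => -[x t] /=.
  move=> h; split; first exact: (h ord0).
  by move=> i; have := h (lift ord0 i); rewrite /tcons/= tnthS.
move=> [h0 h] i; case: (unliftP ord0 i) => [j|] ->; last exact: h0.
by rewrite /tcons/= tnthS.
Qed.

Definition mx_of_tuple m n (t : (m * n).-tuple mR) : 'M[R]_(m, n) :=
  \matrix_(i, j) tnth t (mxvec_index i j).

Lemma measurable_mx_of_tuple m n : measurable_fun setT (@mx_of_tuple m n).
Proof.
apply/measurable_fun_mxP => i j.
rewrite [X in measurable_fun _ X](_ : _ =
  fun t : (m * n).-tuple mR => tnth t (mxvec_index i j)); first exact: measurable_tnth.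
by apply/funext => t; rewrite mxE.
Qed.

HB.instance Definition _ m n := isMeasurableFun.Build _ _ _ _
  (@mx_of_tuple m n) (@measurable_mx_of_tuple m n).

(* The law P_theta of a matrix with independent entries X i j ~ N(theta i j, 1);
   [gaussian_mx_lawE] characterizes it. The second argument of [normal_prob] is
   the standard deviation. *)
Definition gaussian_mx_law m n (theta : 'M[R]_(m, n)) :
    probability 'M[R]_(m, n) R :=
  distribution (tuple_law (fun k => normal_prob (mxvec theta 0 k) 1))
    (@mx_of_tuple m n).

Lemma gaussian_mx_lawE m n (theta : 'M[R]_(m, n)) (B : 'I_m -> 'I_n -> set mR) :
  (forall i j, measurable (B i j)) ->
  gaussian_mx_law theta [set X | forall i j, B i j (X i j)] =
  (\prod_(i < m) \prod_(j < n) normal_prob (theta i j) 1%R (B i j))%E.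
Proof.
move=> mB; rewrite /gaussian_mx_law /= /distribution /pushforward.
pose ix (k : 'I_(m * n)) := enum_val (cast_ord (esym (mxvec_cast m n)) k).
have ixE i j : ix (mxvec_index i j) = (i, j).
  by rewrite /ix /mxvec_index cast_ordK enum_rankK.
transitivity (tuple_law (fun k => normal_prob (mxvec theta 0 k) 1)
    [set t | forall k, B (ix k).1 (ix k).2 (tnth t k)]).
  congr (tuple_law _ _); apply/seteqP; split => t /= h.
    by move=> k; case/mxvec_indexP: k => i j; have := h i j; rewrite mxE ixE.
  by move=> i j; have := h (mxvec_index i j); rewrite mxE ixE.
rewrite (@tuple_lawE _ _ (fun k => B (ix k).1 (ix k).2)); last by move=> k; exact: mB.
rewrite pair_bigA/= (reindex _ (curry_mxvec_bij m n))/=.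
by apply: eq_bigr => -[i j] _ /=; rewrite ixE mxvecE.
Qed.

End product_law.

Section detection.
Context {R : realType}.

Definition Theta (A : R) (n N : nat) : set 'M[R]_N :=
  [set theta : 'M[R]_N | exists Rs Cs : {set 'I_N},
    [/\ #|Rs| = n, #|Cs| = n,
        forall i j, (i \in Rs) && (j \in Cs) -> A <= theta i j &
        forall i j, ~~ ((i \in Rs) && (j \in Cs)) -> theta i j = 0]].

Arguments Theta : clear implicits.

Definition test_risk (A : R) (n N : nat) (T : 'M[R]_N -> bool) : \bar R :=
  (gaussian_mx_law 0%R [set X | T X = true] +
   ereal_sup [set gaussian_mx_law theta [set X | T X = false]
             | theta in Theta A n N])%E.

(* The infimum is taken in the extended reals; for n <= N it is a real number
   between 0 and 1, see [minimax_risk_itv], so that [fine] loses nothing. *)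
Definition minimax_risk_ereal (A : R) (n N : nat) : \bar R :=
  ereal_inf [set test_risk A n T
            | T in [set T : 'M[R]_N -> bool | measurable_fun setT T]].

Definition minimax_risk (n N : nat) (A : R) : R := fine (minimax_risk_ereal A n N).

Lemma minimax_risk_itv (A : R) (n N : nat) :
  (n <= N)%N -> (0 <= minimax_risk_ereal A n N <= 1)%E.
Proof.
move=> nN.
have [theta thT] : Theta A n N !=set0.
  have [S _ cS] : exists2 S : {set 'I_N}, true & #|S| = n.
    have : (0 < #|[set S : {set 'I_N} | #|S| == n]%SET|)%N.
      by rewrite card_draws card_ord bin_gt0.
    by case/card_gt0P => S; rewrite inE => /eqP SE; exists S.
  exists (\matrix_(i, j) if (i \in S) && (j \in S) then A else 0).
  by exists S, S; split => // i j; rewrite mxE; case: ifP.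
apply/andP; split.
  apply/le_ereal_inf_tmp => _ [T mT <-]; rewrite adde_ge0 ?measure_ge0//.
  apply: (@le_trans _ _ (gaussian_mx_law theta [set X | T X = false])).
    exact: measure_ge0.
  by apply: ereal_sup_ubound; exists theta.
apply: (@le_trans _ _ (test_risk A n (fun _ : 'M[R]_N => false))).
  by apply: ereal_inf_lbound; exists (fun=> false) => //; exact: measurable_cst.
rewrite /test_risk (_ : [set X | false = true] = set0) ?measure0 ?add0e//.
  apply: ge_ereal_sup => _ [th _ <-].
  by rewrite (_ : [set X | false = false] = setT) ?probability_setT//; apply/seteqP; split.
by apply/seteqP; split.
Qed.

(* [Num.truncn] is the floor, as [n%:R `^ (1 + alpha)] is nonnegative. *)
Definition risk (alpha : R) (n : nat) (A : R) : R :=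
  minimax_risk n (Num.truncn (n%:R `^ (1 + alpha))) A.

Definition Astar (delta alpha : R) (n : nat) : R :=
  Num.min (n%:R `^ (- (1 - alpha - delta)))
          (Num.sqrt (4 * (1 + delta) * alpha * ln n%:R / n%:R)).

End detection.

Arguments Theta {R} A n N _.

(* Main.v *)
Require Import Defs.
From mathcomp Require Import all_boot all_order all_algebra.
From mathcomp Require Import all_classical all_reals all_analysis.
From mathcomp Require Import measurable_realfun ring lra.
Import Order.TTheory GRing.Theory Num.Theory numFieldNormedType.Exports.
Local Open Scope classical_set_scope.
Local Open Scope ring_scope.
Set Implicit Arguments.
Unset Strict Implicit.
Unset Printing Implicit Defensive.

(** For [alpha + delta <= 1/2] and [n] large, the signal strength is
    [A = n ^ -(1 - alpha - delta)] ([Astar_pow]). Since [N] is about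
    [n ^ (1 + alpha)], the total signal [n ^ 2 * A], divided by the standard
    deviation [N] of the sum of all the entries, is about [n ^ delta], which
    tends to 0. Both bounds say that the gap [1 - R] is of this order; taking
    logarithms then gives the limit ([cvg_ln_ratio]).

    Lower bound on the gap. Reject when the sum of the entries is positive.
    That sum is Gaussian ([ge0_integral_gaussian_mx_sum], from the convolution
    of Gaussian measures [normal_prob_conv]), so the alternative shifts its mean
    by at least [n ^ 2 * A], and the probability of rejection grows by the mass
    of an interval next to the mean, at least a constant times
    [min 1 (n ^ 2 * A / N)] ([normal_prob_shift_gain], [minimax_risk_ub]).

    Upper bound on the gap. Replace the supremum over alternatives by the
    average over a finite family of means, and let [chi] be the second moment
    of the likelihood ratio of that mixture, minus 1. Then the gap of every test
    is at most [(chi + l ^ 2) / (2 * l)] for each [l > 0] ([average_power_ub],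
    [minimax_risk_lb]), and the second moment is the average of
    [exp (theta, theta')], with the entrywise inner product, over pairs of the
    family ([integral_likelihood_ratioM]). The family is obtained by cutting the
    index range into [n] blocks of length about [N / n] and choosing one index
    in each block, independently for the rows and for the columns. Two draws then share
    [K] rows and [K'] columns, with [K] and [K'] independent and binomial, and
    [(theta, theta') = A ^ 2 * K * K']. Integrating over [K'] and then over [K]
    bounds the second moment by the exponential of a constant times
    [n ^ (2 * delta)] ([block_prior_second_moment]). The exponent [A ^ 2 * K]
    met on the way is at most [A ^ 2 * n], and [alpha + delta <= 1/2] is what
    keeps this below 1, where the exponential is comparable to its linear part.
    The choice [l = n ^ delta] ends the proof ([risk_gap_ub]). *)

(** * Densities and translations *)

Section density.
Local Open Scope ereal_scope.
Context d (T : measurableType d) (R : realType).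
Import HBNNSimple.

(** Simple functions approximate [f] from below; on them the identity reduces
    to indicators, that is to the hypothesis on [nu]. *)
Lemma ge0_integral_density (mu nu : {measure set T -> \bar R}) (g : T -> R)
    (f : T -> \bar R) :
  measurable_fun setT g -> (forall x, 0 <= g x)%R ->
  (forall A, measurable A -> nu A = \int[mu]_(x in A) (g x)%:E) ->
  measurable_fun setT f -> (forall x, 0 <= f x) ->
  \int[nu]_x f x = \int[mu]_x (f x * (g x)%:E).
Proof.
move=> mg g0 nuE mf f0; pose f_ := nnsfun_approx measurableT mf.
have f_cvg x : (f_ n x)%:E @[n --> \oo] --> f x.
  by apply: (cvg_nnsfun_approx measurableT mf) => // *; exact: f0.
have mgE : measurable_fun setT (EFin \o g) by exact/measurable_EFinP.
transitivity (limn (fun n => \int[nu]_x (f_ n x)%:E)).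
  rewrite -monotone_convergence//.
  - by apply: eq_integral => x _; apply/esym/cvg_lim => //.
  - by move=> n; exact/measurable_EFinP/measurable_funP.
  - by move=> n y _; rewrite lee_fin.
  - by move=> y _ m n mn; rewrite lee_fin; exact/lefP/nd_nnsfun_approx.
rewrite [X in limn X](_ : _ = (fun n => \int[mu]_x ((f_ n x)%:E * (g x)%:E))).
  rewrite -monotone_convergence//.
  - apply: eq_integral => x _; apply/cvg_lim => //.
    by apply: cvgeZr => //; exact: f_cvg.
  - move=> n; apply: emeasurable_funM => //; exact/measurable_EFinP/measurable_funP.
  - by move=> n y _; rewrite mule_ge0// lee_fin.
  - move=> y _ m n mn; rewrite lee_wpmul2r ?lee_fin//.
    exact/lefP/nd_nnsfun_approx.
apply/funext => n.
transitivity (\sum_(k \in range (f_ n)) \int[nu]_x (k * \1_(f_ n @^-1` [set k]) x)%:E).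
  under eq_integral do rewrite fimfunE -fsumEFin//.
  rewrite ge0_integral_fsum//.
  - by move=> y; exact/measurable_EFinP/measurable_funM.
  - by move=> y x _; rewrite nnfun_muleindic_ge0.
transitivity (\sum_(k \in range (f_ n))
    \int[mu]_x ((k * \1_(f_ n @^-1` [set k]) x)%:E * (g x)%:E)); last first.
  rewrite -ge0_integral_fsum//.
  - apply: eq_integral => x _.
    by rewrite [in RHS]fimfunE -fsumEFin// ge0_mule_fsuml// => k; rewrite nnfun_muleindic_ge0.
  - by move=> r; apply: emeasurable_funM => //; exact/measurable_EFinP/measurable_funM.
  - by move=> r x _; apply: mule_ge0; [rewrite EFinM nnfun_muleindic_ge0|rewrite lee_fin].
apply: eq_fsbigr => k _; rewrite integralZl_indic_nnsfun// integral_indic// setIT nuE//.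
have [k0|k0] := ltP k 0%R.
  rewrite preimage_nnfun0// integral_set0 mule0.
  by under eq_integral do rewrite indic0 mulr0 mul0e; rewrite integral0.
under [RHS]eq_integral do rewrite EFinM -muleA.
rewrite ge0_integralZl//.
- congr (_ * _); rewrite integral_mkcond; apply: eq_integral => x _.
  rewrite patchE; case: ifPn => [/set_mem xA|/negP xA].
    by rewrite indicE mem_set// mul1e.
  by rewrite indicE memNset ?mul0e// => /mem_set.
- by apply: emeasurable_funM => //; exact/measurable_EFinP.
- by move=> x _; rewrite mule_ge0// lee_fin.
Qed.

End density.

Section lebesgue_translation.
Local Open Scope ereal_scope.
Context {R : realType}.
Local Notation mu := (@lebesgue_measure R).

Lemma lebesgue_measure_translation (a : R) (A : set R) : measurable A ->
  pushforward mu (fun x : measurableTypeR R => (x + a)%R : measurableTypeR R) A = mu A.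
Proof.
move=> mA; have ms : measurable_fun setT
    (fun x : measurableTypeR R => (x + a)%R : measurableTypeR R).
  exact: measurable_funD.
apply/esym; apply: lebesgue_measure_unique => //= _ [[x y]] _ <-.
rewrite /pushforward [X in _ = mu X](_ : _ = `](x - a)%R, (y - a)%R]%classic).
  rewrite !lebesgue_measure_itv/= !lte_fin ltrD2r; case: ifP => // _.
  by rewrite -!EFinB; congr EFin; ring.
by apply/seteqP; split => z /=; rewrite !in_itv/= ltrBlDr lerBrDr.
Qed.

Lemma ge0_integral_translation (a : R) (f : R -> \bar R) :
  measurable_fun setT f -> (forall x, 0 <= f x) ->
  \int[mu]_x f (x + a)%R = \int[mu]_x f x.
Proof.
move=> mf f0; have ms : measurable_fun setT
    (fun x : measurableTypeR R => (x + a)%R : measurableTypeR R).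
  exact: measurable_funD.
rewrite -[LHS](ge0_integral_pushforward ms mu (D := setT))//.
by apply: eq_measure_integral => A mA _; exact: lebesgue_measure_translation.
Qed.

End lebesgue_translation.

(** * Gaussian measures on the line *)

Section normal.
Local Open Scope ereal_scope.
Context {R : realType}.
Local Notation mu := (@lebesgue_measure R).
Implicit Types (f : R -> \bar R) (a b m s x : R).

Lemma normal_pdf_tilt a x :
  (normal_pdf a 1 x = normal_pdf 0 1 x * expR (a * x - a ^+ 2 / 2))%R.
Proof.
rewrite !normal_pdfE ?oner_eq0//; rewrite -mulrA; congr (_ * _)%R.
by rewrite /normal_fun -expRD; congr expR; field.
Qed.

(** Completing the square in [x]: for independent [X] and [Y] of densities
    [normal_pdf a 1] and [normal_pdf b s], the joint density of [X] and
    [X + Y] factors into the density of [X + Y] and the conditional density of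
    [X]. The second factor integrates to 1 in [x]. *)
Lemma normal_pdf_conv a b s t x z : (0 < s -> 0 < t -> t ^+ 2 = 1 + s ^+ 2 ->
  normal_pdf a 1 x * normal_pdf b s (z - x) =
  normal_pdf (a + b) t z * normal_pdf (a + (z - a - b) / t ^+ 2) (s / t) x)%R.
Proof.
move=> s0 t0 ts.
have sN0 : (s != 0)%R by rewrite gt_eqF.
have tN0 : (t != 0)%R by rewrite gt_eqF.
have t2 : (1 + s ^+ 2 != 0)%R by rewrite -ts expf_neq0.
rewrite !normal_pdfE ?oner_eq0// ?mulf_neq0 ?invr_eq0// mulrACA [RHS]mulrACA.
congr (_ * _)%R.
  rewrite /normal_peak -!invfM -!sqrtrM; do ?[by rewrite mulrn_wge0// mulr_ge0 ?sqr_ge0 ?pi_ge0].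
  by congr (Num.sqrt _)^-1%R; field.
rewrite /normal_fun -!expRD; congr expR.
rewrite exprMn exprVn ts; field.
by rewrite t2 sN0.
Qed.

Lemma measurable_normal_pdfE m s :
  measurable_fun setT (fun x : R => (normal_pdf m s x)%:E).
Proof. by apply/measurable_EFinP; exact: measurable_normal_pdf. Qed.

(** Every integral against a Gaussian measure is moved to Lebesgue measure by
    this lemma, where translations and completed squares are available. *)
Lemma ge0_integral_normal_prob m s f :
  measurable_fun setT f -> (forall x, 0 <= f x) ->
  \int[normal_prob m s]_x f x = \int[mu]_x (f x * (normal_pdf m s x)%:E).
Proof.
move=> mf f0; apply: ge0_integral_density => //.
- exact: measurable_normal_pdf.
- exact: normal_pdf_ge0.
Qed.

Lemma ge0_integral_normal_tilt a f :
  measurable_fun setT f -> (forall x, 0 <= f x) ->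
  \int[normal_prob a 1]_x f x =
  \int[normal_prob 0 1]_x (f x * (expR (a * x - a ^+ 2 / 2))%:E).
Proof.
move=> mf f0; rewrite !ge0_integral_normal_prob//.
- by apply: eq_integral => x _; rewrite normal_pdf_tilt EFinM [X in _ * X]muleC muleA.
- apply: emeasurable_funM => //; apply/measurable_EFinP; apply: measurableT_comp => //.
  by apply: measurable_funB => //; exact: measurable_funM.
- by move=> x; rewrite mule_ge0// lee_fin expR_ge0.
Qed.

(** The sum of independent Gaussian variables is Gaussian: substitute
    [y = z - x], exchange the integrals, and integrate out the second factor of
    [normal_pdf_conv]. *)
Lemma normal_prob_conv a b s t f : (0 < s)%R -> (0 < t)%R -> (t ^+ 2 = 1 + s ^+ 2)%R ->
  measurable_fun setT f -> (forall x, 0 <= f x) ->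
  \int[normal_prob a 1]_x \int[normal_prob b s]_y f (x + y)%R =
  \int[normal_prob (a + b) t]_z f z.
Proof.
move=> s0 t0 ts mf f0.
pose G (x z : R) : \bar R :=
  f z * ((normal_pdf a 1 x)%:E * (normal_pdf b s (z - x))%:E).
have G0 x z : 0 <= G x z by rewrite !mule_ge0// lee_fin normal_pdf_ge0.
have mpdf m' s' : measurable_fun setT (normal_pdf m' s' : R -> R).
  exact: measurable_normal_pdf.
have mG : measurable_fun setT (fun p : measurableTypeR R * measurableTypeR R => G p.1 p.2).
  apply: emeasurable_funM.
    exact: (measurableT_comp mf measurable_snd).
  apply: emeasurable_funM; apply/measurable_EFinP.
    exact: (measurableT_comp (mpdf _ _) measurable_fst).
  apply: (measurableT_comp (mpdf _ _)).
  exact: (measurable_funB measurable_snd measurable_fst).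
(* after the substitution y = z - x *)
have inner x : \int[normal_prob b s]_y f (x + y)%R * (normal_pdf a 1 x)%:E =
    \int[mu]_z G x z.
  have mfx : measurable_fun setT (fun y => f (x + y)%R).
    by apply: (measurableT_comp mf); exact: measurable_funD.
  rewrite ge0_integral_normal_prob//.
  rewrite -(ge0_integral_translation x (f := G x))//; last first.
    exact: (measurableT_comp mG (pair1_measurable x)).
  rewrite -ge0_integralZr//.
  - apply: eq_integral => y _; rewrite /G addrK [(x + y)%R]addrC -muleA.
    by congr (_ * _); rewrite muleC.
  - by apply: emeasurable_funM => //; exact: measurable_normal_pdfE.
  - by move=> y _; rewrite mule_ge0// lee_fin normal_pdf_ge0.
  - by rewrite lee_fin normal_pdf_ge0.
have mF : measurable_fun setT (fun x => \int[normal_prob b s]_y f (x + y)%R).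
  apply: (@measurable_fun_fubini_tonelli_F _ _ _ _ _ (normal_prob b s)
    (fun p : measurableTypeR R * measurableTypeR R => f (p.1 + p.2)%R)) => //.
  by apply: (measurableT_comp mf); exact: (measurable_funD measurable_fst measurable_snd).
rewrite ge0_integral_normal_prob//; last by move=> x; exact: integral_ge0.
under eq_integral do rewrite inner.
transitivity (\int[mu]_z \int[mu]_x G x z).
  exact: (@fubini_tonelli _ _ (measurableTypeR R) (measurableTypeR R) R mu mu
    (fun p => G p.1 p.2)).
rewrite ge0_integral_normal_prob//; apply: eq_integral => z _.
rewrite /G; under eq_integral => x _ do rewrite -EFinM (normal_pdf_conv a b x z s0 t0 ts) EFinM.
rewrite ge0_integralZl//; last 2 first.
- by apply: emeasurable_funM => //; exact: measurable_normal_pdfE.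
- by move=> x _; rewrite mule_ge0// lee_fin normal_pdf_ge0.
rewrite ge0_integralZl//; last 3 first.
- exact: measurable_normal_pdfE.
- by move=> x _; rewrite lee_fin normal_pdf_ge0.
- by rewrite lee_fin normal_pdf_ge0.
by rewrite integral_normal_pdf mule1.
Qed.


End normal.

(** * Products of Gaussian measures *)

Section tuple_law.
Local Open Scope ereal_scope.
Context {R : realType}.
Local Notation mR := (measurableTypeR R).

Lemma ge0_integral_tuple_lawS n (P : 'I_n.+1 -> probability mR R)
    (f : n.+1.-tuple mR -> \bar R) :
  measurable_fun setT f -> (forall x, 0 <= f x) ->
  \int[tuple_law P]_t f t =
  \int[P ord0]_x \int[tuple_law (fun i => P (lift ord0 i))]_t f (tcons (x, t)).
Proof.
move=> mf f0 /=.
rewrite ge0_integral_pushforward// preimage_setT fubini_tonelli1//=.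
exact: measurableT_comp.
Qed.

Lemma sum_tnth_tcons n (x : mR) (t : n.-tuple mR) (F : 'I_n.+1 -> R -> R) :
  (\sum_(k < n.+1) F k (tnth (tcons (x, t)) k) =
   F ord0 x + \sum_(k < n) F (lift ord0 k) (tnth t k))%R.
Proof.
rewrite big_ord_recl; congr (_ + _)%R.
by apply: eq_bigr => k _; rewrite /tcons/= tnthS.
Qed.

Lemma measurable_sum_tnth n (F : 'I_n -> R -> R) :
  (forall k, measurable_fun setT (F k)) ->
  measurable_fun setT (fun t : n.-tuple mR => \sum_(k < n) F k (tnth t k))%R.
Proof.
move=> mF; apply: measurable_sum => k.
by apply: (measurableT_comp (mF k)); exact: measurable_tnth.
Qed.

(** The density of a product law is the product of the one-dimensional
    densities, which Tonelli peels off one coordinate at a time. *)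
Lemma ge0_integral_tuple_law_tilt n (a : 'I_n -> R) (f : n.-tuple mR -> \bar R) :
  measurable_fun setT f -> (forall x, 0 <= f x) ->
  \int[tuple_law (fun k => normal_prob (a k) 1)]_t f t =
  \int[tuple_law (fun k => normal_prob 0 1)]_t
    (f t * (expR (\sum_(k < n) (a k * tnth t k - a k ^+ 2 / 2)))%:E).
Proof.
elim: n a f => [|n IH] a f mf f0.
  apply: eq_integral => t _.
  by rewrite big_ord0 expR0 mule1.
have mtilt m (b : 'I_m -> R) : measurable_fun setT (fun t : m.-tuple mR =>
    (expR (\sum_(k < m) (b k * tnth t k - b k ^+ 2 / 2)))%:E).
  apply/measurable_EFinP; apply: measurableT_comp => //.
  apply: (measurable_sum_tnth (F := fun k x => (b k * x - b k ^+ 2 / 2)%R)) => k.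
  by apply: measurable_funB => //; exact: measurable_funM.
apply: (eq_trans (ge0_integral_tuple_lawS (fun k => normal_prob (a k) 1) mf f0)).
have mg := emeasurable_funM mf (mtilt _ a).
have g0 t : 0 <= f t * (expR (\sum_(k < n.+1) (a k * tnth t k - a k ^+ 2 / 2)))%:E.
  by rewrite mule_ge0// lee_fin expR_ge0.
apply: (eq_trans _ (esym (ge0_integral_tuple_lawS (fun k => normal_prob 0 1) mg g0))).
rewrite ge0_integral_normal_tilt//; last 2 first.
- apply: (@measurable_fun_fubini_tonelli_F _ _ _ _ _
    (tuple_law (fun k => normal_prob (a (lift ord0 k)) 1)) (fun p => f (tcons p))) => //.
  exact: measurableT_comp.
- by move=> x; exact: integral_ge0.
apply: eq_integral => x _.
have mfx : measurable_fun setT (fun t : n.-tuple mR => f (tcons (x, t))).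
  apply: (measurableT_comp mf).
  exact: (measurableT_comp (@measurable_tcons R n) (pair1_measurable x)).
rewrite IH// -ge0_integralZr//.
- apply: eq_integral => t _.
  by rewrite (sum_tnth_tcons _ _ (fun k x => a k * x - a k ^+ 2 / 2)%R) expRD EFinM muleA muleAC.
- by apply: emeasurable_funM => //; exact: (mtilt _ (fun k => a (lift ord0 k))).
- by move=> t _; rewrite mule_ge0// lee_fin expR_ge0.
Qed.

(** Induction on the number of terms with [normal_prob_conv]. It starts with
    one term and not with none, because [normal_prob _ 0] is the uniform law on
    the unit interval instead of a point mass. *)
Lemma ge0_integral_tuple_law_sum n (a : 'I_n.+1 -> R) (f : R -> \bar R) :
  measurable_fun setT f -> (forall x, 0 <= f x) ->
  \int[tuple_law (fun k => normal_prob (a k) 1)]_t f (\sum_(k < n.+1) tnth t k)%R =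
  \int[normal_prob (\sum_(k < n.+1) a k)%R (Num.sqrt n.+1%:R)]_x f x.
Proof.
have msum m : measurable_fun setT (fun t : m.-tuple mR => \sum_(k < m) tnth t k)%R.
  exact: (measurable_sum_tnth (F := fun _ => id)).
elim: n a f => [|n IH] a f mf f0; have mg m : measurable_fun setT
    (fun t : m.-tuple mR => f (\sum_(k < m) tnth t k)%R) := measurableT_comp mf (msum m).
  apply: (eq_trans (ge0_integral_tuple_lawS (fun k => normal_prob (a k) 1) (mg 1%N) (fun=> f0 _))).
  rewrite big_ord_recl big_ord0 addr0 sqrtr1; apply: eq_integral => x _.
  rewrite integral_dirac//; last first.
    apply: (measurableT_comp (mg _)).
    exact: (measurableT_comp (@measurable_tcons R 0) (pair1_measurable x)).
  by rewrite diracT mul1e (sum_tnth_tcons _ _ (fun=> id)) big_ord0 addr0.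
apply: (eq_trans (ge0_integral_tuple_lawS (fun k => normal_prob (a k) 1) (mg n.+2) (fun=> f0 _))).
rewrite big_ord_recl -(@normal_prob_conv _ _ _ (Num.sqrt n.+1%:R))//.
- apply: eq_integral => x _; rewrite -IH//.
    by apply: eq_integral => t _; rewrite (sum_tnth_tcons _ _ (fun=> id)).
  by apply: (measurableT_comp mf); exact: measurable_funD.
- by rewrite !sqr_sqrtr// -natr1 addrC.
Qed.

End tuple_law.

(** * Gaussian matrices *)

Section gaussian_matrix.
Local Open Scope ereal_scope.
Context {R : realType}.
Local Notation mR := (measurableTypeR R).

Lemma sum_mxvec_index m n (V : nmodType) (F : 'I_(m * n) -> V) :
  (\sum_(k < m * n) F k = \sum_(i < m) \sum_(j < n) F (mxvec_index i j))%R.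
Proof.
by rewrite pair_bigA/= (reindex _ (curry_mxvec_bij m n))/=; apply: eq_bigr => -[].
Qed.

Lemma measurable_sum_mx m n (F : 'I_m -> 'I_n -> R -> R) :
  (forall i j, measurable_fun setT (F i j)) ->
  measurable_fun setT (fun X : 'M[R]_(m, n) => \sum_i \sum_j F i j (X i j))%R.
Proof.
move=> mF; apply: measurable_sum => i; apply: measurable_sum => j.
exact: (measurableT_comp (mF i j) (measurable_mx_entry (i, j))).
Qed.

(** Logarithm of the density of the law of mean [theta] with respect to the
    centred law. *)
Definition log_likelihood m n (theta X : 'M[R]_(m, n)) : R :=
  (\sum_i \sum_j (theta i j * X i j - theta i j ^+ 2 / 2))%R.

Lemma measurable_log_likelihood m n (theta : 'M[R]_(m, n)) :
  measurable_fun setT (log_likelihood theta).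
Proof.
apply: (measurable_sum_mx (F := fun i j x => (theta i j * x - theta i j ^+ 2 / 2)%R)) => i j.
by apply: measurable_funB => //; exact: measurable_funM.
Qed.

Lemma ge0_integral_gaussian_mx_tilt m n (theta : 'M[R]_(m, n))
    (f : 'M[R]_(m, n) -> \bar R) :
  measurable_fun setT f -> (forall X, 0 <= f X) ->
  \int[gaussian_mx_law theta]_X f X =
  \int[gaussian_mx_law 0%R]_X (f X * (expR (log_likelihood theta X))%:E).
Proof.
move=> mf f0; rewrite /gaussian_mx_law.
have mg : measurable_fun setT (fun X => f X * (expR (log_likelihood theta X))%:E).
  apply: emeasurable_funM => //; apply/measurable_EFinP; apply: measurableT_comp => //.
  exact: measurable_log_likelihood.
have g0 X : 0 <= f X * (expR (log_likelihood theta X))%:E.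
  by rewrite mule_ge0// lee_fin expR_ge0.
apply: (eq_trans (ge0_integral_distribution _ mf f0)).
apply: (eq_trans _ (esym (ge0_integral_distribution _ mg g0))).
have mfX : measurable_fun setT (f \o @mx_of_tuple R m n).
  exact: (measurableT_comp mf (@measurable_mx_of_tuple R m n)).
apply: (eq_trans (ge0_integral_tuple_law_tilt _ mfX _)) => [t /=|]; first exact: f0.
have -> : (fun k => normal_prob (mxvec (0 : 'M[R]_(m, n)) 0 k)%R 1 : probability mR R) =
    (fun=> normal_prob 0 1 : probability mR R).
  by apply/funext => k; rewrite linear0 mxE.
apply: eq_integral => t _ /=; congr (_ * (expR _)%:E).
rewrite sum_mxvec_index; apply: eq_bigr => i _; apply: eq_bigr => j _.
by rewrite mxvecE mxE.
Qed.

(** The sum of the entries is the statistic of the test below. Flattening the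
    matrix reduces its law to that of the sum over a tuple. *)
Lemma ge0_integral_gaussian_mx_sum m n (theta : 'M[R]_(m.+1, n.+1)) (f : R -> \bar R) :
  measurable_fun setT f -> (forall x, 0 <= f x) ->
  \int[gaussian_mx_law theta]_X f (\sum_i \sum_j X i j)%R =
  \int[normal_prob (\sum_i \sum_j theta i j)%R (Num.sqrt (m.+1 * n.+1)%:R)]_x f x.
Proof.
move=> mf f0.
have mg : measurable_fun setT (fun X : 'M[R]_(m.+1, n.+1) => f (\sum_i \sum_j X i j)%R).
  exact: (measurableT_comp mf (measurable_sum_mx (F := fun _ _ => id) _)).
apply: (eq_trans (ge0_integral_distribution _ mg (fun=> f0 _))).
rewrite (_ : (\sum_i \sum_j theta i j)%R = (\sum_(k < m.+1 * n.+1) mxvec theta 0 k)%R); last first.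
  by rewrite sum_mxvec_index; apply: eq_bigr => i _; apply: eq_bigr => j _; rewrite mxvecE.
rewrite -[RHS](@ge0_integral_tuple_law_sum _ (n + m * n.+1) (fun k => mxvec theta 0 k)%R)//.
apply: eq_integral => t _ /=; congr f.
rewrite [RHS](@sum_mxvec_index m.+1 n.+1 _ (fun k => tnth t k)).
by apply: eq_bigr => i _; apply: eq_bigr => j _; rewrite mxE.
Qed.

End gaussian_matrix.

(** * The test based on the sum of the entries *)

Section linear_test.
Context {R : realType}.
Local Notation mu := (@lebesgue_measure R).

Lemma normal_pdf_shift (m s x : R) : s != 0 -> normal_pdf m s (x + m) = normal_pdf 0 s x.
Proof. by move=> s0; rewrite !normal_pdfE// /normal_fun addrK subr0. Qed.

Lemma normal_pdf_std (s : R) : 0 < s -> normal_pdf 0 s s = normal_pdf 0 1 1 / s.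
Proof.
move=> s0; rewrite !normal_pdfE ?gt_eqF//.
rewrite (_ : normal_fun 0 s s = normal_fun 0 1 1); last first.
  by congr expR; field; rewrite gt_eqF.
rewrite mulrAC; congr (_ * _); rewrite /normal_peak.
rewrite -!mulrnAr sqrtrM ?sqr_ge0// sqrtr_sqr gtr0_norm// invfM expr1n mul1r mulrC.
by [].
Qed.

Lemma normal_prob_translation (m s : R) : s != 0 ->
  normal_prob m s `]0, +oo[ = normal_prob 0 s `](- m), +oo[ :> \bar R.
Proof.
move=> s0.
rewrite /normal_prob integral_mkcond [RHS]integral_mkcond.
rewrite -(@ge0_integral_translation _ m); last 2 first.
- apply: (iffLR (measurable_restrictT _ _)) => //; apply: measurable_funTS.
  exact: measurable_normal_pdfE.
- by move=> x; rewrite erestrict_ge0// => y _; rewrite lee_fin normal_pdf_ge0.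
apply: eq_integral => x _; rewrite !patchE.
rewrite (_ : (x + m \in _) = (x \in `](- m), +oo[%classic)); last first.
  by apply/idP/idP; rewrite !inE/= !in_itv/= !andbT -ltrBlDr sub0r.
by case: ifP => // _; rewrite normal_pdf_shift.
Qed.

(** Within one standard deviation of its mean, the density stays above the
    value that it takes at distance one standard deviation. *)
Lemma normal_prob_itv_lb (r s : R) : 0 <= r -> r <= s -> 0 < s ->
  ((r / s * normal_pdf 0 1 1)%:E <= normal_prob 0 s `](- r)%R, 0%R])%E.
Proof.
move=> r0 rs s0; rewrite /normal_prob.
rewrite (_ : (_ / _ * _)%:E = \int[mu]_(x in `](- r)%R, 0%R]) (normal_pdf 0 s s)%:E)%E; last first.
  rewrite integral_cst//= lebesgue_measure_itv/= lte_fin (normal_pdf_std s0).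
  case: ltP => [_|]; first by rewrite -EFinB -EFinM; congr EFin; ring.
  move=> h; have -> : r = 0 by lra.
  by rewrite mule0 mul0r mul0r.
apply: ge0_le_integral => //.
- by move=> x _; rewrite lee_fin normal_pdf_ge0.
- by apply: measurable_funTS; exact: measurable_normal_pdfE.
move=> x /=; rewrite in_itv/= => /andP[xr x0]; rewrite lee_fin !normal_pdfE ?gt_eqF//.
apply: ler_wpM2l; first exact: normal_peak_ge0.
rewrite ler_expR !subr0 ler_pM2r ?invr_gt0 ?pmulrn_lgt0 ?exprn_gt0// lerN2; nra.
Qed.

(** Moving the mean from 0 to [m] amounts to moving the threshold from 0 to
    [- m], which adds an interval of length [m] next to the mean. Cutting it at
    one standard deviation keeps [normal_prob_itv_lb] applicable. *)
Lemma normal_prob_shift_gain (m s : R) : 0 <= m -> 0 < s ->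
  (normal_prob 0 s `]0%R, +oo[ + (Num.min 1 (m / s) * normal_pdf 0 1 1)%:E <=
   normal_prob m s `]0%R, +oo[)%E.
Proof.
move=> m0 s0; pose r := Num.min s m.
have r0 : 0 <= r by rewrite le_min m0 ltW.
have -> : Num.min 1 (m / s) = r / s.
  by rewrite minr_pMl ?invr_ge0 ?ltW// divff// gt_eqF.
rewrite (@normal_prob_translation m) ?gt_eqF//.
apply: (@le_trans _ _ (normal_prob 0 s `]0%R, +oo[ + normal_prob 0 s `](- r)%R, 0%R])%E).
  by rewrite leeD2l// normal_prob_itv_lb// ge_min lexx.
rewrite -measureU//.
- apply: le_measure; rewrite ?inE//; first exact: measurableU.
  have rm : r <= m by rewrite ge_min lexx orbT.
  by move=> x /= []; rewrite !in_itv/= ?andbT => h; [|case/andP: h => h _]; lra.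
- by apply/seteqP; split => // x /= []; rewrite !in_itv/= andbT => h1 /andP[_ h2]; lra.
Qed.

Definition mx_sum m n (X : 'M[R]_(m, n)) : R := \sum_i \sum_j X i j.

Lemma measurable_mx_sum m n : measurable_fun setT (@mx_sum m n).
Proof. exact: (measurable_sum_mx (F := fun _ _ => id)). Qed.

Lemma gaussian_mx_sum_gt0 N (theta : 'M[R]_N.+1) :
  gaussian_mx_law theta [set X | (0 < mx_sum X) = true] =
  normal_prob (mx_sum theta) N.+1%:R `]0%R, +oo[.
Proof.
have mI : measurable_fun setT (fun x : R => (\1_`]0, +oo[ x)%:E : \bar R).
  by apply/measurable_EFinP; exact: measurable_indic.
have I0 (x : R) : (0 <= (\1_`]0, +oo[ x)%:E :> \bar R)%E by rewrite lee_fin.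
transitivity (\int[normal_prob (mx_sum theta) N.+1%:R]_x (\1_`]0, +oo[ x)%:E)%E; last first.
  by rewrite integral_indic// setIT.
(* the N.+1 ^ 2 unit variances add up to standard deviation N.+1 *)
rewrite (_ : N.+1%:R = Num.sqrt (N.+1 * N.+1)%:R); last first.
  by rewrite natrM -expr2 sqrtr_sqr ger0_norm.
apply: (eq_trans _ (@ge0_integral_gaussian_mx_sum _ N N theta _ mI I0)).
have mP : measurable [set X : 'M[R]_N.+1 | (0 < mx_sum X) = true].
  rewrite (_ : mkset _ = @mx_sum N.+1 N.+1 @^-1` `]0, +oo[); last first.
    by apply/seteqP; split => X /=; rewrite in_itv/= andbT.
  by rewrite -[X in measurable X]setTI; exact: measurable_mx_sum.
transitivity (\int[gaussian_mx_law theta]_X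
    (\1_[set X : 'M[R]_N.+1 | (0 < mx_sum X) = true] X)%:E)%E.
  by rewrite integral_indic// setIT.
apply: eq_integral => X _; rewrite !indicE; congr (_%:R)%:E; congr nat_of_bool.
by apply/idP/idP; rewrite !inE/= in_itv/= andbT.
Qed.

Lemma mx_sum_Theta_lb (A : R) n N (theta : 'M[R]_N) :
  Theta A n N theta -> n%:R ^+ 2 * A <= mx_sum theta.
Proof.
move=> [Rs [Cs [cR cC thA th0]]].
rewrite /mx_sum (bigID (mem Rs))/= [X in _ <= _ + X]big1 ?addr0; last first.
  by move=> i iR; apply: big1 => j _; rewrite th0// (negbTE iR).
apply: (@le_trans _ _ (\sum_(i in Rs) \sum_(j in Cs) A)).
  by rewrite !sumr_const cR cC -mulrnA -[leRHS]mulr_natl natrM expr2.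
apply: ler_sum => i iR; rewrite [leRHS](bigID (mem Cs))/= [X in _ <= _ + X]big1 ?addr0.
  by apply: ler_sum => j jC; apply: thA; rewrite iR.
by move=> j jC; rewrite th0// (negbTE jC) andbF.
Qed.

(** The test rejects when the sum of the entries is positive. That sum has
    standard deviation [N], and mean at least [n ^ 2 * A] under every
    alternative, so [normal_prob_shift_gain] compares its two errors. *)
Lemma minimax_risk_ub (A : R) n N : 0 <= A -> (0 < n <= N)%N ->
  minimax_risk n N A <= 1 - Num.min 1 (n%:R ^+ 2 * A / N%:R) * normal_pdf 0 1 1.
Proof.
case: N => [|N]; first by rewrite ltnNge; case: n.
move=> A0 /andP[n0 nN]; set g := Num.min _ _ * _.
have /andP[risk0 risk1] := minimax_risk_itv A nN.
rewrite -lee_fin /minimax_risk fineK; last first.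
  by rewrite ge0_fin_numE// (le_lt_trans risk1)// ltry.
pose T (X : 'M[R]_N.+1) := 0 < mx_sum X.
have mT : measurable_fun setT T.
  by apply: measurable_fun_ltr => //; exact: measurable_mx_sum.
have T1E theta : gaussian_mx_law theta [set X | T X = true] =
  normal_prob (mx_sum theta) N.+1%:R `]0%R, +oo[ := gaussian_mx_sum_gt0 theta.
have mT1 : measurable [set X | T X = true].
  by have := mT measurableT [set true]; rewrite setTI; apply.
have T0E theta : (gaussian_mx_law theta [set X | T X = false] =
    1 - normal_prob (mx_sum theta) N.+1%:R `]0%R, +oo[)%E.
  rewrite -T1E -probability_setC//; congr (gaussian_mx_law theta _).
  by apply/seteqP; split => X /=; case: (T X).
apply: (@le_trans _ _ (test_risk A n T)).
  by apply: ereal_inf_lbound; exists T.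
have sum0 : mx_sum (0 : 'M[R]_N.+1) = 0.
  by rewrite /mx_sum big1// => i _; rewrite big1// => j _; rewrite mxE.
pose p0 : \bar R := normal_prob 0 N.+1%:R `]0%R, +oo[.
have P0E : gaussian_mx_law 0 [set X | T X = true] = p0 by have := T1E 0; rewrite sum0.
have P0le : (gaussian_mx_law 0%R [set X | T X = true] <= p0)%E by rewrite P0E.
have p0fin : p0 \is a fin_num by exact: fin_num_measure.
have le_sup : (ereal_sup [set gaussian_mx_law theta [set X | T X = false]
    | theta in Theta A n N.+1] <= (1 - g)%:E - p0)%E.
  apply: ge_ereal_sup => _ [theta thT <-]; apply: (eq_ind_r (fun z => z <= _)%E _ (T0E theta)).
  have m0 : 0 <= n%:R ^+ 2 * A by rewrite mulr_ge0 ?sqr_ge0.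
  have gain := normal_prob_shift_gain (le_trans m0 (mx_sum_Theta_lb thT)) (ltr0Sn R N).
  have gle : (g%:E <= (Num.min 1 (mx_sum theta / N.+1%:R) * normal_pdf 0 1 1)%:E)%E.
    rewrite lee_fin ler_wpM2r ?normal_pdf_ge0// le_min ge_min lexx/=.
    by rewrite ge_min ler_pM2r ?invr_gt0// mx_sum_Theta_lb// orbT.
  rewrite EFinB -[leRHS]addeA leeD2l// -oppeD ?fin_num_adde_defl// leeN2.
  rewrite addeC; apply: le_trans gain; exact: leeD2l.
apply: (le_trans (leeD P0le le_sup)).
by rewrite addeCA subee// adde0.
Qed.

End linear_test.

(** * Second moments of likelihood ratios *)

Section second_moment.
Context {R : realType}.

Lemma ge0_integral_lincomb d (T : measurableType d) (mu : {measure set T -> \bar R})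
    (J : finType) (c : J -> R) (f : J -> T -> R) :
  (forall j, 0 <= c j) -> (forall j x, 0 <= f j x) ->
  (forall j, measurable_fun setT (f j)) ->
  (\int[mu]_x (\sum_j c j * f j x)%:E = \sum_j (c j)%:E * \int[mu]_x (f j x)%:E)%E.
Proof.
move=> c0 f0 mf.
transitivity (\int[mu]_x (\sum_j (c j)%:E * (f j x)%:E))%E.
  by apply: eq_integral => x _; rewrite -sumEFin.
have mfE j : measurable_fun setT (fun x => (f j x)%:E) by exact/measurable_EFinP.
rewrite ge0_integral_sum//.
- by apply: eq_bigr => j _; rewrite ge0_integralZl ?lee_fin// => x _; rewrite lee_fin.
- by move=> j; apply: emeasurable_funM.
- by move=> j x _; rewrite mule_ge0// lee_fin.
Qed.

(** The constant [a] integrates to itself because [P] is a probability. *)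
Lemma ge0_integral_affine2 d (T : measurableType d) (P : probability T R) (a b : R)
    (f g : T -> R) :
  0 <= a -> 0 <= b -> (forall x, 0 <= f x) -> (forall x, 0 <= g x) ->
  measurable_fun setT f -> measurable_fun setT g ->
  (\int[P]_x (f x + a + b * g x)%:E =
   \int[P]_x (f x)%:E + a%:E + b%:E * \int[P]_x (g x)%:E)%E.
Proof.
move=> a0 b0 f0 g0 mf mg.
have := @ge0_integral_lincomb _ _ P 'I_3 (fun j => nth 0 [:: 1; a; b] j)
  (fun j x => nth 0 [:: f x; 1; g x] j).
have P1 : (\int[P]_x 1%:E = 1%:E)%E.
  by rewrite integral_cst// mul1e; exact: probability_setT.
rewrite !big_ord_recl big_ord0/= P1 !mule1 mul1e adde0 addeA => <-.
- by apply: eq_integral => x _; rewrite !big_ord_recl big_ord0/= mul1r mulr1 addr0 addrA.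
- by move=> [[|[|[|]]]].
- by move=> [[|[|[|]]]].
- by move=> [[|[|[|]]]].
Qed.

Definition mx_dot m n (X Y : 'M[R]_(m, n)) : R := \sum_i \sum_j X i j * Y i j.

(** A product of two likelihood ratios is, up to the factor
    [expR (mx_dot s t)], the likelihood ratio of [s + t]. This is why its
    integral is explicit. *)
Lemma log_likelihoodD m n (s t X : 'M[R]_(m, n)) :
  log_likelihood s X + log_likelihood t X = mx_dot s t + log_likelihood (s + t) X.
Proof.
rewrite /log_likelihood /mx_dot -!big_split/=; apply: eq_bigr => i _.
by rewrite -!big_split/=; apply: eq_bigr => j _; rewrite !mxE; field.
Qed.

Definition likelihood_ratio m n (t X : 'M[R]_(m, n)) : R := expR (log_likelihood t X).

Lemma measurable_likelihood_ratio m n (t : 'M[R]_(m, n)) : measurable_fun setT (likelihood_ratio t).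
Proof. by apply: measurableT_comp => //; exact: measurable_log_likelihood. Qed.

Lemma integral_likelihood_ratio_indic m n (t : 'M[R]_(m, n)) (B : set 'M[R]_(m, n)) :
  measurable B ->
  (\int[gaussian_mx_law 0%R]_X (\1_B X * likelihood_ratio t X)%:E = gaussian_mx_law t B)%E.
Proof.
move=> mB.
have m1 : measurable_fun setT (fun X => (\1_B X)%:E : \bar R).
  by apply/measurable_EFinP; exact: measurable_indic.
have ge1 X : (0 <= (\1_B X)%:E :> \bar R)%E by rewrite lee_fin.
transitivity (\int[gaussian_mx_law t]_X (\1_B X)%:E)%E.
  by apply: (eq_trans _ (esym (ge0_integral_gaussian_mx_tilt t m1 ge1))).
by rewrite integral_indic// setIT.
Qed.

Lemma integral_likelihood_ratio m n (t : 'M[R]_(m, n)) :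
  (\int[gaussian_mx_law 0%R]_X (likelihood_ratio t X)%:E = 1)%E.
Proof.
rewrite -(probability_setT (gaussian_mx_law t)) -integral_likelihood_ratio_indic//.
by apply: eq_integral => X _; rewrite indicT mul1r.
Qed.

Lemma integral_likelihood_ratioM m n (s t : 'M[R]_(m, n)) :
  (\int[gaussian_mx_law 0%R]_X (likelihood_ratio s X * likelihood_ratio t X)%:E =
   (expR (mx_dot s t))%:E)%E.
Proof.
transitivity (\int[gaussian_mx_law 0%R]_X
    ((expR (mx_dot s t))%:E * (likelihood_ratio (s + t) X)%:E))%E.
  by apply: eq_integral => X _; rewrite /likelihood_ratio -expRD log_likelihoodD expRD.
rewrite ge0_integralZl//.
- by rewrite integral_likelihood_ratio mule1.
- by apply/measurable_EFinP; exact: measurable_likelihood_ratio.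
- by move=> X _; rewrite lee_fin expR_ge0.
Qed.

Section mixture.
Variables (I : finType) (N : nat) (th : I -> 'M[R]_N).
Let w : R := #|I|%:R^-1.
Let L (X : 'M[R]_N) : R := \sum_i w * likelihood_ratio (th i) X.
Let P0 := gaussian_mx_law (0%R : 'M[R]_N).
Hypothesis I0 : (0 < #|I|)%N.

Let w0 : 0 <= w. Proof. by rewrite invr_ge0. Qed.

Let sumw : \sum_(i : I) w = 1.
Proof. by rewrite sumr_const /w -[LHS]mulr_natr mulVf// pnatr_eq0 -lt0n. Qed.

Let L0 X : 0 <= L X.
Proof. by apply: sumr_ge0 => i _; rewrite mulr_ge0// expR_ge0. Qed.

Let mL : measurable_fun setT L.
Proof.
by apply: measurable_sum => i; apply: measurable_funM => //; exact: measurable_likelihood_ratio.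
Qed.

Let int_L : (\int[P0]_X (L X)%:E = 1)%E.
Proof.
rewrite /L ge0_integral_lincomb//; last 2 first.
- by move=> *; exact: expR_ge0.
- by move=> *; exact: measurable_likelihood_ratio.
rewrite -[RHS]/(1%:E) -sumw -sumEFin.
by apply: eq_bigr => i _; rewrite integral_likelihood_ratio mule1.
Qed.

Let int_L1 B : measurable B ->
  (\int[P0]_X (\1_B X * L X)%:E = \sum_i w%:E * gaussian_mx_law (th i) B)%E.
Proof.
move=> mB; rewrite (eq_integral (fun X =>
    (\sum_i w * (\1_B X * likelihood_ratio (th i) X))%:E)); last first.
  by move=> X _; rewrite /L mulr_sumr; congr EFin; apply: eq_bigr => i _; rewrite mulrCA.
rewrite ge0_integral_lincomb//.
- by apply: eq_bigr => i _; rewrite integral_likelihood_ratio_indic.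
- by move=> i X; rewrite mulr_ge0// expR_ge0.
- by move=> i; apply: measurable_funM => //; exact: measurable_likelihood_ratio.
Qed.

Let int_LL : (\int[P0]_X (L X * L X)%:E =
  (\sum_i \sum_j w * w * expR (mx_dot (th i) (th j)))%:E)%E.
Proof.
rewrite (eq_integral (fun X => (\sum_(p : I * I) (w * w) *
    (likelihood_ratio (th p.1) X * likelihood_ratio (th p.2) X))%:E)); last first.
  move=> X _; rewrite /L big_distrlr/= pair_bigA/=; congr EFin.
  by apply: eq_bigr => p _; ring.
rewrite ge0_integral_lincomb//.
- rewrite pair_bigA/= -sumEFin; apply: eq_bigr => p _.
  by rewrite integral_likelihood_ratioM.
- by move=> _; rewrite mulr_ge0.
- by move=> i X; rewrite mulr_ge0// expR_ge0.
- by move=> i; apply: measurable_funM => //; exact: measurable_likelihood_ratio.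
Qed.

(** Write [L] for the likelihood ratio of the mixture. Integrate the pointwise
    bound [2 * L + 2 * l * 1_B * L <= L ^ 2 + 1 + l ^ 2 + 2 * l * 1_B]: on [B]
    it says [0 <= (L - 1 - l) ^ 2], off [B] it says [0 <= (L - 1) ^ 2 + l ^ 2].
    Optimizing over [l] would give the usual bound of the total variation
    distance by the square root of the chi-square distance; with [l] left free
    all the integrands are nonnegative and no square root occurs. *)
Lemma average_power_ub (B : set 'M[R]_N) (l : R) : measurable B -> 0 < l ->
  \sum_i w * fine (gaussian_mx_law (th i) B) <=
  fine (P0 B) + (\sum_i \sum_j w * w * expR (mx_dot (th i) (th j)) - 1 + l ^+ 2) / (2 * l).
Proof.
move=> mB l0; set q := (X in X <= _); set m2 := \sum_i \sum_j _.
have int_L1E : (\int[P0]_X (\1_B X * L X)%:E = q%:E)%E.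
  rewrite int_L1// /q -sumEFin; apply: eq_bigr => i _.
  by rewrite EFinM fineK// fin_num_measure.
have P0E : (\int[P0]_X (\1_B X)%:E = (fine (P0 B))%:E)%E.
  by rewrite integral_indic// setIT fineK// fin_num_measure.
have mLE : measurable_fun setT (EFin \o L) by exact/measurable_EFinP.
have m1 : measurable_fun setT (\1_B : 'M[R]_N -> R) by exact: measurable_indic.
have lhsE : (\int[P0]_X (2 * L X + 2 * l * (\1_B X * L X))%:E = (2 + 2 * l * q)%:E)%E.
  have := @ge0_integral_lincomb _ _ P0 bool (fun b => if b then 2 else 2 * l)
    (fun b X => if b then L X else \1_B X * L X).
  rewrite big_bool/= int_L int_L1E mule1 -EFinM -EFinD => <-.
  - by apply: eq_integral => X _; rewrite big_bool.
  - by case=> //; rewrite mulr_ge0// ltW.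
  - by case=> // X; rewrite mulr_ge0.
  - by case=> //; exact: measurable_funM.
have rhsE : (\int[P0]_X (L X * L X + (1 + l ^+ 2) + 2 * l * \1_B X)%:E =
    (m2 + (1 + l ^+ 2) + 2 * l * fine (P0 B))%:E)%E.
  rewrite ge0_integral_affine2 ?addr_ge0 ?sqr_ge0//.
  - by rewrite int_LL P0E -EFinM -!EFinD.
  - by rewrite mulr_ge0// ltW.
  - by move=> X; rewrite mulr_ge0.
  - exact: measurable_funM.
have : ((2 + 2 * l * q)%:E <= (m2 + (1 + l ^+ 2) + 2 * l * fine (P0 B))%:E)%E.
  rewrite -lhsE -rhsE; apply: ge0_le_integral => //.
  - move=> X _; have l2 : 0 <= 2 * l by rewrite mulr_ge0// ltW.
    by rewrite lee_fin addr_ge0// mulr_ge0// mulr_ge0.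
  - apply/measurable_EFinP; apply: measurable_funD; apply: measurable_funM => //.
    exact: measurable_funM.
  - apply/measurable_EFinP; apply: measurable_funD; last exact: measurable_funM.
    by apply: measurable_funD => //; exact: measurable_funM.
  move=> X _; rewrite lee_fin indicE.
  have := sqr_ge0 (L X - 1 - l); have := sqr_ge0 (L X - 1); have := sqr_ge0 l.
  by move: (L X) => x; case: (X \in B); rewrite /= ?mulr1n ?mulr0n; nra.
rewrite lee_fin => key.
rewrite -lerBlDl ler_pdivlMr ?mulr_gt0//; lra.
Qed.

End mixture.

(** The worst case over [Theta A n N] is at least the average over the family
    [th], whose laws mix to one alternative to be told from the centred law. *)
Lemma minimax_risk_lb (I : finType) (n N : nat) (A l : R) (th : I -> 'M[R]_N) :
  (n <= N)%N -> (0 < #|I|)%N -> (forall i, Theta A n N (th i)) -> 0 < l ->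
  1 - (\sum_i \sum_j #|I|%:R^-1 * #|I|%:R^-1 * expR (mx_dot (th i) (th j)) - 1 + l ^+ 2)
      / (2 * l) <= minimax_risk n N A.
Proof.
move=> nN I0 thT l0; set g := (_ / _).
have /andP[risk0 risk1] := minimax_risk_itv A nN.
rewrite -lee_fin /minimax_risk fineK; last first.
  by rewrite ge0_fin_numE// (le_lt_trans risk1)// ltry.
apply/le_ereal_inf_tmp => _ [T mT <-].
have mT1 : measurable [set X | T X = true].
  by have := mT measurableT [set true]; rewrite setTI; apply.
pose w : R := #|I|%:R^-1.
pose p0 := fine (gaussian_mx_law (0 : 'M[R]_N) [set X | T X = true]).
have power : \sum_i w * fine (gaussian_mx_law (th i) [set X | T X = true]) <= p0 + g :=
  average_power_ub th I0 mT1 l0.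
have le_risk i : ((p0 + (1 - fine (gaussian_mx_law (th i) [set X | T X = true])))%:E <=
    test_risk A n T)%E.
  rewrite EFinD; apply: leeD.
    by rewrite /p0 fineK// fin_num_measure.
  rewrite EFinB fineK ?fin_num_measure// -probability_setC//.
  rewrite (_ : ~` _ = [set X | T X = false]); last first.
    by apply/seteqP; split => X /=; case: (T X).
  by apply: ereal_sup_ubound; exists (th i).
(* the risk may a priori be infinite; only the finite case needs the average *)
case: (test_risk A n T) le_risk => [r| |] le_risk; first 2 last.
- by case/card_gt0P: I0 => i _; have := le_risk i; rewrite leeNy_eq.
- rewrite lee_fin.
  have sumw : \sum_(i : I) w = 1.
    by rewrite sumr_const /w -[LHS]mulr_natr mulVf// pnatr_eq0 -lt0n.
  have w0 : 0 <= w by rewrite invr_ge0.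
  have : \sum_(i : I) w * (p0 + (1 - fine (gaussian_mx_law (th i) [set X | T X = true])))
      <= \sum_(i : I) w * r.
    by apply: ler_sum => i _; apply: ler_wpM2l => //; rewrite -lee_fin.
  rewrite -mulr_suml sumw mul1r.
  under eq_bigr do rewrite addrA mulrBr.
  rewrite sumrB -mulr_suml sumw mul1r; lra.
- exact: leey.
Qed.

End second_moment.

(** * A prior with one index per block *)

Section block_prior.
Context {R : realType}.

Definition agreement n M (f g : {ffun 'I_n -> 'I_M}) : nat := \sum_i (f i == g i).

Lemma agreement_le n M (f g : {ffun 'I_n -> 'I_M}) : (agreement f g <= n)%N.
Proof.
rewrite -[X in (_ <= X)%N]card_ord -sum1_card; apply: leq_sum => i _.
by case: (f i == g i).
Qed.

(** This is [1 - s <= expR (- s)] multiplied by [expR s]. *)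
Lemma expR_sub1_le_mul (s : R) : expR s - 1 <= s * expR s.
Proof.
have e0 : 0 < expR s := expR_gt0 s.
have := ler_wpM2l (ltW e0) (expR_ge1Dx (- s)).
by rewrite expRN mulfV ?gt_eqF//; lra.
Qed.

Lemma expR_sub1_le (s : R) : 0 <= s <= 1 -> expR s - 1 <= expR 1 * s.
Proof.
move=> /andP[s0 s1]; apply: (le_trans (expR_sub1_le_mul s)).
by rewrite mulrC ler_wpM2r// ler_expR.
Qed.

(** The exponential of the agreement is a product over the blocks, so the sum
    over all choices factors; in each block one choice agrees with [f] and [M]
    do not. *)
Lemma sum_expR_agreement n M (f : {ffun 'I_n -> 'I_M.+1}) (s : R) :
  \sum_g expR (s * (agreement f g)%:R) = (M%:R + expR s) ^+ n.
Proof.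
transitivity (\prod_(i < n) \sum_(j < M.+1) expR (s * (f i == j)%:R)).
  rewrite bigA_distr_bigA; apply: eq_bigr => g _.
  by rewrite /agreement natr_sum mulr_sumr expR_sum.
rewrite (eq_bigr (fun=> M%:R + expR s)) ?prodr_const ?card_ord// => i _.
rewrite (bigD1 (f i))//= eqxx mulr1 addrC; congr (_ + _).
rewrite (eq_bigr (fun=> 1)) => [|j /negbTE]; last first.
  by rewrite eq_sym => ->; rewrite mulr0 expR0.
by rewrite sumr_const cardC1 card_ord.
Qed.

(** For a uniform [g], the agreement with [f] is binomial with parameters [n]
    and [1 / M.+1]; compare its moment generating function with that of the
    Poisson law of the same mean, and linearize the exponent for [s <= 1]. *)
Lemma agreement_mgf_le n M (f : {ffun 'I_n -> 'I_M.+1}) (s : R) : 0 <= s <= 1 ->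
  (M.+1%:R ^+ n)^-1 * \sum_g expR (s * (agreement f g)%:R)
  <= expR (expR 1 * n%:R / M.+1%:R * s).
Proof.
move=> s01; rewrite sum_expR_agreement -exprVn -exprMn.
have -> : expR 1 * n%:R / M.+1%:R * s = M.+1%:R^-1 * (expR 1 * s) * n%:R by ring.
rewrite expRM_natr; apply: lerXn2r; rewrite ?nnegrE ?expR_ge0//.
apply: le_trans (expR_ge1Dx _).
have -> : M.+1%:R^-1 * (M%:R + expR s) = 1 + M.+1%:R^-1 * (expR s - 1).
  by rewrite -natr1; field; rewrite natr1 pnatr_eq0.
by rewrite lerD2l ler_wpM2l ?invr_ge0// expR_sub1_le.
Qed.

Section prior.
Variables (n M N : nat).
Hypothesis nMN : (n * M.+1 <= N)%N.

Let pos_subproof (i : 'I_n) (j : 'I_M.+1) : (i * M.+1 + j < N)%N.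
Proof.
apply: leq_trans nMN; apply: (@leq_trans (i.+1 * M.+1)); last by rewrite leq_mul2r ltn_ord orbT.
by rewrite mulSn addnC ltn_add2r ltn_ord.
Qed.

(** The hypothesis [nMN] lets the range of size [N] contain [n] consecutive
    disjoint blocks of length [M.+1]. *)
Definition block_pos i j : 'I_N := Ordinal (pos_subproof i j).

Lemma block_pos_inj i i' j j' : block_pos i j = block_pos i' j' -> i = i' /\ j = j'.
Proof.
move=> /(congr1 val)/= E.
have Ei : i = i' :> nat.
  by have := congr1 (divn^~ M.+1) E; rewrite !divnMDl// !divn_small// !addn0.
split; apply/val_inj => //=.
by move: E; rewrite Ei => /addnI.
Qed.

Definition block_set (f : {ffun 'I_n -> 'I_M.+1}) : {set 'I_N} :=
  [set block_pos i (f i) | i : 'I_n]%SET.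

Lemma card_block_set f : #|block_set f| = n.
Proof. by rewrite card_imset ?card_ord// => i j /block_pos_inj[]. Qed.

Lemma sum_block_set (f : {ffun 'I_n -> 'I_M.+1}) (F : 'I_N -> R) :
  \sum_(k in block_set f) F k = \sum_i F (block_pos i (f i)).
Proof. by rewrite big_imset//= => i j _ _ /block_pos_inj[]. Qed.

Lemma block_pos_in i j f : (block_pos i j \in block_set f) = (j == f i).
Proof.
apply/imsetP/eqP => [[i' _ /block_pos_inj[<- //]]|->]; by exists i.
Qed.

Definition block_theta (A : R) (p : {ffun 'I_n -> 'I_M.+1} * {ffun 'I_n -> 'I_M.+1}) :
  'M[R]_N := \matrix_(k, l) (A * (k \in block_set p.1)%:R * (l \in block_set p.2)%:R).

Lemma block_theta_Theta A p : Theta A n N (block_theta A p).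
Proof.
exists (block_set p.1), (block_set p.2); rewrite !card_block_set; split => // k l.
  by rewrite mxE => /andP[-> ->]; rewrite !mulr1.
by rewrite mxE negb_and => /orP[] /negbTE ->; rewrite ?mulr0 ?mul0r.
Qed.

Lemma sum_block_agreement f g :
  \sum_k (k \in block_set f)%:R * (k \in block_set g)%:R = (agreement f g)%:R :> R.
Proof.
rewrite (eq_bigr (fun k => if k \in block_set f then (k \in block_set g)%:R else 0)).
  rewrite -big_mkcond sum_block_set natr_sum; apply: eq_bigr => i _.
  by rewrite block_pos_in.
by move=> k _; case: ifP => _; rewrite ?mul1r ?mul0r.
Qed.

Lemma mx_dot_block_theta A p q : mx_dot (block_theta A p) (block_theta A q) =
  A ^+ 2 * (agreement p.1 q.1)%:R * (agreement p.2 q.2)%:R.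
Proof.
rewrite -!sum_block_agreement -mulrA big_distrlr mulr_sumr; apply: eq_bigr => k _.
rewrite mulr_sumr; apply: eq_bigr => l _; rewrite !mxE.
have aux (a b c d : R) : A * a * b * (A * c * d) = A ^+ 2 * (a * c * (b * d)) by ring.
exact: aux.
Qed.

End prior.

Local Notation block_choice n M := ({ffun 'I_n -> 'I_M.+1} * {ffun 'I_n -> 'I_M.+1})%type.

(** Two independent draws share [K] rows and [K'] columns, where [K] and [K']
    are independent. Averaging over [K'] with [K] fixed applies
    [agreement_mgf_le] at [s = A ^ 2 * K], which is at most 1 by the first
    hypothesis; averaging the result over [K] applies it again at
    [s = rho * A ^ 2], which is at most 1 by the second one. *)
Lemma block_prior_second_moment n M (A : R) (rho := expR 1 * n%:R / M.+1%:R) :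
  A ^+ 2 * n%:R <= 1 -> rho * A ^+ 2 <= 1 ->
  \sum_(p : block_choice n M) \sum_(q : block_choice n M)
    #|{: block_choice n M}|%:R^-1 * #|{: block_choice n M}|%:R^-1 *
    expR (A ^+ 2 * (agreement p.1 q.1)%:R * (agreement p.2 q.2)%:R)
  <= expR ((rho * A) ^+ 2).
Proof.
move=> A2n rA2; set v : R := (M.+1%:R ^+ n)^-1.
have v0 : 0 <= v by rewrite invr_ge0 exprn_ge0.
have rho0 : 0 <= rho by rewrite !mulr_ge0 ?expR_ge0 ?invr_ge0.
have IE : #|{: block_choice n M}|%:R^-1 = v * v :> R.
  by rewrite card_prod card_ffun !card_ord natrM natrX invfM.
have sumv : \sum_(f : {ffun 'I_n -> 'I_M.+1}) v = 1.
  by rewrite sumr_const card_ffun !card_ord -[LHS]mulr_natr natrX mulVf.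
have inner (p : block_choice n M) : v * v * \sum_(q : block_choice n M)
    expR (A ^+ 2 * (agreement p.1 q.1)%:R * (agreement p.2 q.2)%:R) <= expR ((rho * A) ^+ 2).
  rewrite -(pair_bigA _ (fun f g =>
    expR (A ^+ 2 * (agreement p.1 f)%:R * (agreement p.2 g)%:R)))/=.
  rewrite -mulrA mulr_sumr.
  apply: (@le_trans _ _ (v * \sum_f expR (rho * A ^+ 2 * (agreement p.1 f)%:R))).
    apply: ler_wpM2l => //; apply: ler_sum => f _.
    rewrite -mulrA; apply: agreement_mgf_le.
    rewrite mulr_ge0 ?sqr_ge0//= (le_trans _ A2n)// ler_wpM2l ?sqr_ge0// ler_nat.
    exact: agreement_le.
  apply: (le_trans (agreement_mgf_le _ _)); first by rewrite mulr_ge0 ?sqr_ge0.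
  by rewrite ler_expR exprMn expr2 -/rho -!mulrA.
rewrite IE; apply: (@le_trans _ _ (\sum_(p : block_choice n M) v * v * expR ((rho * A) ^+ 2))).
  apply: ler_sum => p _; rewrite -mulr_sumr -mulrA; apply: ler_wpM2l; first exact: mulr_ge0.
  exact: inner.
rewrite -mulr_suml -(pair_bigA _ (fun f g : {ffun 'I_n -> 'I_M.+1} => v * v))/=.
by under eq_bigr do rewrite -mulr_sumr sumv mulr1; rewrite sumv mul1r.
Qed.

Lemma minimax_risk_block_lb n M N (A l : R) (rho := expR 1 * n%:R / M.+1%:R) :
  (n * M.+1 <= N)%N -> A ^+ 2 * n%:R <= 1 -> rho * A ^+ 2 <= 1 -> 0 < l ->
  1 - (expR ((rho * A) ^+ 2) - 1 + l ^+ 2) / (2 * l) <= minimax_risk n N A.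
Proof.
move=> nMN A2n rA2 l0.
have nN : (n <= N)%N by apply: leq_trans nMN; rewrite leq_pmulr.
have I0 : (0 < #|{: {ffun 'I_n -> 'I_M.+1} * {ffun 'I_n -> 'I_M.+1}}|)%N.
  by rewrite card_prod card_ffun !card_ord muln_gt0 expn_gt0.
apply: le_trans (minimax_risk_lb nN I0 (block_theta_Theta nMN A) l0).
rewrite lerD2l lerN2 ler_pM2r ?invr_gt0 ?mulr_gt0// lerD2r lerD2r.
apply: le_trans (block_prior_second_moment A2n rA2).
by apply: ler_sum => p _; apply: ler_sum => q _; rewrite mx_dot_block_theta.
Qed.

End block_prior.

(** * The regime of large n *)

Section asymptotics.
Context {R : realType}.

Lemma near_ln_natr_ge (K : R) : \forall n \near \oo, K <= ln (n%:R : R).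
Proof.
have h : \forall n \near \oo, expR K <= (n%:R : R) by move/cvgryPge: (@cvgr_idn R); exact.
apply: filterS h => n Kn; rewrite -[leLHS]expRK ler_ln// posrE ?expR_gt0//.
exact: lt_le_trans (expR_gt0 _) Kn.
Qed.

(** The logarithm of [u n / n ^ delta] stays bounded, so that dividing by
    [ln n] leaves only the exponent. *)
Lemma cvg_ln_ratio (u : nat -> R) (c C delta : R) : 0 < c ->
  (\forall n \near \oo, c <= u n / n%:R `^ delta <= C) ->
  (ln (u n) / ln (n%:R : R) @[n --> \oo] --> delta)%classic.
Proof.
move=> c0 uc; apply/cvgrPdist_le => e e0.
near=> n.
have /andP[cu uC] : c <= u n / n%:R `^ delta <= C by near: n.
have lnn1 : 1 <= ln (n%:R : R) by near: n; exact: near_ln_natr_ge.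
have lnn : (`|ln c| + `|ln C|) / e <= ln (n%:R : R) by near: n; exact: near_ln_natr_ge.
have ln0 : 0 < ln (n%:R : R) by exact: lt_le_trans lnn1.
have n0 : 0 < (n%:R : R).
  by rewrite ltNge; apply/negP => n0; move: ln0; rewrite ln0// ltxx.
set q := u n / _ in cu uC.
have q0 : 0 < q by exact: lt_le_trans cu.
have uE : u n = q * n%:R `^ delta by rewrite divfK// gt_eqF// powR_gt0.
have -> : delta - ln (u n) / ln n%:R = - (ln q / ln n%:R).
  rewrite uE lnM ?posrE ?powR_gt0// ln_powR; field; exact: lt0r_neq0.
rewrite normrN normrM normfV (gtr0_norm ln0) ler_pdivrMr// mulrC -ler_pdivrMr//.
apply: le_trans lnn; rewrite ler_pM2r ?invr_gt0//.
have lnc : ln c <= ln q by rewrite ler_ln ?posrE.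
have lnC : ln q <= ln C by rewrite ler_ln ?posrE// (lt_le_trans q0).
have := ler_norm (ln C); have := lerNnormlW (lexx `|ln c|).
have := normr_ge0 (ln C); have := normr_ge0 (ln c).
rewrite ler_norml; lra.
Unshelve. all: by end_near. Qed.

Section regime.
Variables (alpha delta : R) (n : nat).
Hypothesis n1 : (0 < n)%N.
Local Notation x := (n%:R : R).
Let N := Num.truncn (x `^ (1 + alpha)).
Let A := x `^ (- (1 - alpha - delta)).

Let x1 : 1 <= x. Proof. by rewrite ler1n. Qed.
Let x0 : 0 < x. Proof. exact: lt_le_trans x1. Qed.
Let xge0 : 0 <= x. Proof. exact: ltW. Qed.
Let xN0 : x != 0. Proof. exact: lt0r_neq0. Qed.
Let powx_D s t : x `^ (s + t) = x `^ s * x `^ t.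
Proof. by rewrite powRD// xN0 implybT. Qed.

Let le_powx s t : s <= t -> x `^ s <= x `^ t.
Proof. by move=> st; exact: ler_powR. Qed.

(** As [1 - alpha - delta >= 1 / 2], the first term of the minimum is at most
    [n ^ (- 1 / 2)], and the second one exceeds this once the factor
    of [n ^ -1] under its root is at least 1. *)
Lemma Astar_pow : alpha + delta <= 1 / 2 ->
  1 <= 4 * (1 + delta) * alpha * ln x -> Astar delta alpha n = A.
Proof.
move=> ad large; rewrite /Astar; apply: min_idPl.
apply: (@le_trans _ _ (x `^ (- 2^-1))); first by apply: le_powx; lra.
have ln_ge0 : 0 <= 4 * (1 + delta) * alpha * ln x by exact: le_trans large.
rewrite powRN powR12_sqrt// -sqrtrV// ler_sqrt; last exact: divr_ge0.
by rewrite ler_peMl// invr_ge0.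
Qed.

Lemma n_le_N : 0 < alpha -> (n <= N)%N.
Proof.
move=> alpha0.
rewrite /N truncn_ge_nat ?powR_ge0// -[leLHS]powRr1//.
by apply: le_powx; lra.
Qed.

(** The sum of the signal, in standard deviations, is [n ^ 2 * A / N], and
    [N <= n ^ (1 + alpha)] makes this at least [n ^ delta]. *)
Lemma risk_gap_lb : 0 < alpha -> delta < 0 ->
  x `^ delta * normal_pdf 0 1 1 <= 1 - minimax_risk n N A.
Proof.
move=> alpha0 delta0.
have A0 : 0 <= A by exact: powR_ge0.
have nN : (0 < n <= N)%N by rewrite n1 n_le_N.
have N0 : 0 < (N%:R : R) by rewrite ltr0n (leq_trans n1 (n_le_N alpha0)).
have := minimax_risk_ub A0 nN.
suff : x `^ delta * normal_pdf 0 1 1 <= Num.min 1 (x ^+ 2 * A / N%:R) * normal_pdf 0 1 1 by lra.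
rewrite ler_wpM2r ?normal_pdf_ge0// le_min; apply/andP; split.
  by rewrite -[leRHS](powRr0 x); apply: le_powx; exact: ltW.
rewrite ler_pdivlMr//.
apply: (@le_trans _ _ (x `^ delta * x `^ (1 + alpha))).
  by apply: ler_wpM2l; [exact: powR_ge0|rewrite truncn_le powR_ge0].
rewrite -powR_mulrn// -!powx_D; apply: le_powx; lra.
Qed.

(** With blocks of length [N %/ n], which is at least [n ^ alpha / 2], the
    product [rho * A] of [minimax_risk_block_lb] is at most
    [2 * expR 1 * n ^ delta]; hence the value of [K]. The second moment of the
    block prior is then at most [expR (K * n ^ (2 * delta))], so
    [l = n ^ delta] balances the two terms of the bound. The condition
    [alpha + delta <= 1 / 2] is what makes [A ^ 2 * n <= 1]. *)
Lemma risk_gap_ub (K := 4 * expR 1 ^+ 2) :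
  0 < alpha -> delta < 0 -> alpha + delta <= 1 / 2 -> K <= x ->
  1 - minimax_risk n N A <= (K * expR K + 1) / 2 * x `^ delta.
Proof.
move=> alpha0 delta0 ad Kx.
have : (0 < N %/ n)%N by rewrite divn_gt0// n_le_N.
(* blocks are indexed by M.+1 so that they are visibly nonempty *)
case EM : (N %/ n)%N => [//|M] _.
have nMN : (n * M.+1 <= N)%N by rewrite -EM mulnC leq_divM.
have M0 : 0 < (M.+1%:R : R) by [].
(* N.+1 <= M.+2 * n, and M.+2 is at most twice M.+1 *)
have MN : x `^ alpha <= 2 * M.+1%:R.
  rewrite -(ler_pM2l x0) -[X in X * _](powRr1 xge0) -powx_D.
  apply: (le_trans (ltW (truncnS_gt _))).
  rewrite -!natrM ler_nat -/N.
  have := ltn_ceil N n1; rewrite EM => h; apply: (leq_trans h).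
  by rewrite mulnC leq_mul2l mul2n -addnn addSn addnS !ltnS leq_addl orbT.
set e := expR 1 in K Kx *.
have e0 : 0 <= e by exact: expR_ge0.
pose rho := e * x / M.+1%:R.
have rho0 : 0 <= rho by rewrite !mulr_ge0 ?invr_ge0.
have rho_le : rho <= 2 * e * x `^ (1 - alpha).
  rewrite /rho ler_pdivrMr//.
  have -> : e * x = e * x `^ (1 - alpha) * x `^ alpha by rewrite -mulrA -powx_D subrK powRr1.
  rewrite [leRHS](_ : _ = e * x `^ (1 - alpha) * (2 * M.+1%:R)); last by ring.
  by apply: ler_wpM2l => //; rewrite mulr_ge0 ?powR_ge0.
have A0 : 0 <= A by exact: powR_ge0.
have A2 : A ^+ 2 = x `^ (- (1 - alpha - delta) * 2) by rewrite powRrM powR_mulrn// powR_ge0.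
have A2n : A ^+ 2 * x <= 1.
  rewrite A2 -[X in _ * X](powRr1 xge0) -powx_D -[leRHS](powRr0 x); apply: le_powx; lra.
have rhoA2 : rho * A ^+ 2 <= 1.
  apply: (@le_trans _ _ (2 * e * x `^ (1 - alpha) * A ^+ 2)).
    by apply: ler_wpM2r => //; exact: sqr_ge0.
  rewrite A2 -mulrA -powx_D.
  apply: (@le_trans _ _ (2 * e * x `^ (- 2^-1))).
    by apply: ler_wpM2l; [exact: mulr_ge0|apply: le_powx; lra].
  rewrite powRN powR12_sqrt// ler_pdivrMr ?sqrtr_gt0// mul1r.
  rewrite -[leLHS]ger0_norm; last exact: mulr_ge0.
  rewrite -sqrtr_sqr ler_sqrt//.
  by rewrite exprMn -natrX.
set l := x `^ delta.
have l0 : 0 < l by exact: powR_gt0.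
have lge0 : 0 <= l := ltW l0.
have l1 : l <= 1 by rewrite -[leRHS](powRr0 x); apply: le_powx; exact: ltW.
have rhoA : (rho * A) ^+ 2 <= K * l ^+ 2.
  rewrite (_ : K * l ^+ 2 = (2 * e * l) ^+ 2); last by rewrite /K; ring.
  apply: lerXn2r; rewrite ?nnegrE ?mulr_ge0//.
  apply: (le_trans (ler_wpM2r A0 rho_le)).
  rewrite -[leLHS]mulrA /A -powx_D; apply: ler_wpM2l; first exact: mulr_ge0.
  by apply: le_powx; lra.
have K0 : 0 <= K by rewrite mulr_ge0 ?sqr_ge0.
have chi : expR ((rho * A) ^+ 2) - 1 <= K * expR K * l ^+ 2.
  apply: (le_trans (expR_sub1_le_mul _)).
  rewrite [leRHS]mulrAC; apply: ler_pM; rewrite ?sqr_ge0 ?expR_ge0//.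
  rewrite ler_expR (le_trans rhoA)// -[leRHS]mulr1; apply: ler_wpM2l => //.
  by rewrite expr_le1.
have := minimax_risk_block_lb nMN A2n rhoA2 l0; rewrite -/e -/rho.
suff : (expR ((rho * A) ^+ 2) - 1 + l ^+ 2) / (2 * l) <= (K * expR K + 1) / 2 * l by lra.
rewrite ler_pdivrMr ?mulr_gt0//.
rewrite (_ : (K * expR K + 1) / 2 * l * (2 * l) = K * expR K * l ^+ 2 + l ^+ 2); last by field.
by rewrite lerD2r.
Qed.

End regime.

End asymptotics.

Theorem theorem2p3 (R : realType) :
  exists c C : R, [/\ 0 < c, 0 < C &
    forall alpha delta : R,
      0 < alpha -> -1 < delta -> delta < 0 -> alpha + delta <= 1 / 2 ->
      ((fun n : nat =>
          ln (1 - risk alpha n (Astar delta alpha n)) / ln (n%:R : R))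
         @ \oo --> delta)
      /\
      exists n0 : nat, forall n : nat, (n0 <= n)%N ->
        c <= (1 - risk alpha n (Astar delta alpha n)) / (n%:R `^ delta) <= C].
Proof.
pose K : R := 4 * expR 1 ^+ 2.
have K0 : 0 <= K by rewrite mulr_ge0 ?sqr_ge0.
have c0 : 0 < normal_pdf 0 1 1 :> R.
  by rewrite normal_pdfE ?oner_eq0// mulr_gt0 ?normal_peak_gt0 ?oner_eq0// expR_gt0.
exists (normal_pdf 0 1 1), ((K * expR K + 1) / 2); split => //.
  by rewrite divr_gt0// ltr_wpDl// mulr_ge0// expR_ge0.
move=> alpha delta alpha0 delta1 delta0 ad.
have bounds : \forall n \near \oo, normal_pdf 0 1 1 <=
    (1 - risk alpha n (Astar delta alpha n)) / n%:R `^ delta <= (K * expR K + 1) / 2.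
  near=> n.
  have n1 : (0 < n)%N by near: n; exact: nbhs_infty_gt.
  have Kn : K <= (n%:R : R).
    by near: n; move/cvgryPge: (@cvgr_idn R); exact.
  have lnn : (4 * (1 + delta) * alpha)^-1 <= ln (n%:R : R).
    by near: n; exact: near_ln_natr_ge.
  have p0 : 0 < 4 * (1 + delta) * alpha by rewrite !mulr_gt0//; lra.
  rewrite Astar_pow//; last by rewrite -[leLHS](mulfV (lt0r_neq0 p0)) ler_pM2l.
  have nd0 : 0 < (n%:R : R) `^ delta by rewrite powR_gt0// ltr0n.
  rewrite ler_pdivlMr// ler_pdivrMr// mulrC /risk.
  by rewrite risk_gap_lb// risk_gap_ub.
split; first exact: cvg_ln_ratio c0 bounds.
by case: bounds => n0 _ h; exists n0 => n /h.
Unshelve. all: by end_near. Qed.
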